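(* Let $m\geq 2$, $k\geq 3$ and $n$ be integers with $k\le n$ and $n>3(m-1)$, and let $B_{n,k}$ be any $k$-regular bipartite graph with bipartition $(X,Y)$ such that $|X|=|Y|=n$. Then $$rb(B_{n,k},mK_2)=k(m-2)+2.$$
   Context: All graphs are simple and finite. $mK_2$ denotes a matching of size $m$ (that is, $m$ pairwise disjoint edges). An edge-coloring of a graph $G$ with $r$ colors is an arbitrary (not necessarily proper) assignment of colors to the edges of $G$ in which exactly $r$ distinct colors appear. A subgraph of an edge-colored graph is rainbow if no two of its edges have the same color. For a graph $G$ and a subgraph $H$ of $G$, the rainbow number $rb(G,H)$ is the minimum positive integer $r$ such that every edge-coloring of $G$ with $r$ colors contains a rainbow subgraph isomorphic to $H$. *)

(* Defs.v *)
From mathcomp Require Import all_boot.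
Set Implicit Arguments.
Unset Strict Implicit.
Unset Printing Implicit Defensive.

Record sgraph := SGraph {
  vertex :> finType;
  adj : rel vertex;
  adj_sym : symmetric adj;
  adj_irrefl : irreflexive adj }.

Definition edges (G : sgraph) : {set {set G}} :=
  [set e | [exists x : G, exists y : G, adj x y && (e == [set x; y])]].

Definition regular (k : nat) (G : sgraph) : Prop :=
  forall x : G, #|[set y | adj x y]| = k.

Definition bipartition (G : sgraph) (X Y : {set G}) : Prop :=
  [/\ X :|: Y = [set: G], [disjoint X & Y] &
      forall x y : G, adj x y -> (x \in X) && (y \in Y) || (x \in Y) && (y \in X)].

(* A subgraph is given by its vertex set and its edge set. *)
Definition is_subgraph (G : sgraph) (W : {set G}) (F : {set {set G}}) : bool :=
  (F \subset edges G) && [forall e in F, e \subset W].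

Definition subgraph_iso (G H : sgraph) (W : {set G}) (F : {set {set G}}) : bool :=
  [exists f : {ffun H -> G},
    [&& injectiveb f, f @: [set: H] == W &
        [set f @: (e : {set H}) | e in edges H] == F]].

(* Colors are assigned to all sets of vertices, but only the colors of edges
   are ever looked at; for r > 0 this loses no coloring of the edges. *)
Definition is_edge_coloring (G : sgraph) (r : nat)
    (c : {ffun {set G} -> 'I_r}) : bool :=
  c @: edges G == [set: 'I_r].

Definition rainbow (G : sgraph) (r : nat) (c : {ffun {set G} -> 'I_r})
    (F : {set {set G}}) : bool :=
  [forall e1 in F, forall e2 in F, (c e1 == c e2) ==> (e1 == e2)].

Definition has_rainbow (G H : sgraph) (r : nat)
    (c : {ffun {set G} -> 'I_r}) : bool :=
  [exists W : {set G}, exists F : {set {set G}},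
    [&& is_subgraph W F, subgraph_iso H W F & rainbow c F]].

Definition forces_rainbow (G H : sgraph) (r : nat) : bool :=
  [forall c : {ffun {set G} -> 'I_r}, is_edge_coloring c ==> has_rainbow H c].

Lemma forces_rainbow_ex (G H : sgraph) :
  exists r, (0 < r) && forces_rainbow G H r.
Proof.
exists #|edges G|.+1; rewrite /=; apply/forallP=> c; apply/implyP=> /eqP cE.
by have := leq_imset_card c (edges G); rewrite cE cardsT card_ord ltnn.
Qed.

Definition rb (G H : sgraph) : nat := ex_minn (forces_rainbow_ex G H).

Definition matching_adj (m : nat) : rel ('I_m * bool) :=
  fun u v => (u.1 == v.1) && (u.2 != v.2).

Lemma matching_adj_sym m : symmetric (@matching_adj m).
Proof. by move=> u v; rewrite /matching_adj [u.1 == _]eq_sym [u.2 == _]eq_sym. Qed.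

Lemma matching_adj_irrefl m : irreflexive (@matching_adj m).
Proof. by move=> u; rewrite /matching_adj !eqxx. Qed.

(* The graph m K_2: the i-th edge joins (i, false) and (i, true). *)
Definition matching_graph (m : nat) : sgraph :=
  SGraph (@matching_adj_sym m) (@matching_adj_irrefl m).

(* Main.v *)
(* Upper bound: let H contain one edge of each color. As H has more than k(m-2)
   edges and maximal degree at most k, Konig's theorem gives a matching M of size
   m-1 in H. Suppose that no rainbow mK_2 exists. Since n > 3(m-1), more than
   k(m-1) edges avoid V(M), so they contain a matching of size m; its colors all
   occur on M, hence two disjoint edges e1, e2 outside V(M) have the color of one
   edge e of M. Now H - e still has more than k(m-2) edges, so M - e can be
   augmented in H - e to a matching M1 covering only two new vertices a and b. If
   neither belongs to e, then M1 + e is rainbow of size m; otherwise at most one of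
   a, b lies outside V(M), so it misses e1 or e2, and adding that edge to M1 gives
   a rainbow matching of size m.

   Lower bound: give distinct colors to the k(m-2) edges at m-2 vertices of X and
   one further color to all other edges; for fewer colors, merge some of these. *)
Require Import Defs.
From mathcomp Require Import all_boot zify.
Set Implicit Arguments.
Unset Strict Implicit.
Unset Printing Implicit Defensive.

(** * Auxiliary facts on injectivity, paths and unions *)

Lemma inj_in_setU1 (T : finType) (U : eqType) (f : T -> U) (x : T) (D : {set T}) :
  {in D &, injective f} -> (forall y, y \in D -> f y <> f x) ->
  {in x |: D &, injective f}.
Proof.
move=> fI fx y z /setU1P[->|yD] /setU1P[->|zD] //; last exact: fI.
- by move=> e; case: (fx z zD).
- by move=> e; case: (fx y yD).
Qed.

Lemma sub_path_in (T : eqType) (e e' : rel T) (x : T) (p : seq T) :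
  (forall y z, z \in p -> e y z -> e' y z) -> path e x p -> path e' x p.
Proof.
elim: p x => //= z p IH x sub /andP[exz pth]; apply/andP; split.
  by apply: sub => //; rewrite inE eqxx.
by apply: IH => // y w wp; apply: sub; rewrite inE wp orbT.
Qed.

Lemma card_bigcup_le (I T : finType) (P : {set I}) (F : I -> {set T}) :
  #|\bigcup_(i in P) F i| <= \sum_(i in P) #|F i|.
Proof.
apply: (big_ind2 (fun (X : {set T}) n => #|X| <= n)) => [|X x Y y le1 le2|//].
  by rewrite cards0.
by apply: leq_trans (leq_card_setU _ _) (leq_add le1 le2).
Qed.

(** * Matchings and vertex covers of a bipartite graph given as a set of pairs *)

Section BipartiteMatching.

Variables A B : finType.
Implicit Types E F H M N : {set A * B}.

Definition matching M : Prop :=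
  {in M &, injective fst} /\ {in M &, injective snd}.

Definition avoids M (e : A * B) : Prop :=
  (e.1 \notin fst @: M) /\ (e.2 \notin snd @: M).

Definition cover (S : {set A}) (T : {set B}) F : Prop :=
  forall e, e \in F -> (e.1 \in S) || (e.2 \in T).

Definition degree_le k F : Prop :=
  (forall a, #|[set e in F | e.1 == a]| <= k) /\
  (forall b, #|[set e in F | e.2 == b]| <= k).

Lemma degree_leS k E F : F \subset E -> degree_le k E -> degree_le k F.
Proof.
move=> /subsetP FE [Ea Eb]; split=> [a|b].
- apply: leq_trans (Ea a); apply/subset_leq_card/subsetP=> e.
  by rewrite !inE => /andP[/FE-> ->].
- apply: leq_trans (Eb b); apply/subset_leq_card/subsetP=> e.
  by rewrite !inE => /andP[/FE-> ->].
Qed.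

Lemma matchingS M N : N \subset M -> matching M -> matching N.
Proof.
move=> /subsetP NM [M1 M2].
by split=> x y /NM xM /NM yM; [apply: M1|apply: M2].
Qed.

Lemma avoidsNin M e : avoids M e -> e \notin M.
Proof. by case=> + _; apply: contraNN => eM; apply: imset_f. Qed.

Lemma matchingU1 M e : matching M -> avoids M e -> matching (e |: M).
Proof.
move=> [M1 M2] [e1 e2]; split; apply: inj_in_setU1 => // y yM E.
- by case/negP: e1; rewrite -E imset_f.
- by case/negP: e2; rewrite -E imset_f.
Qed.

Lemma matching_avoidsD1 M e : matching M -> e \in M -> avoids (M :\ e) e.
Proof.
move=> [M1 M2] eM; split; apply/imsetP => -[f /setD1P[fe fM] E].
- by case/eqP: fe; apply: M1.
- by case/eqP: fe; apply: M2.
Qed.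

Lemma cover_card k F S T :
  degree_le k F -> cover S T F -> #|F| <= k * (#|S| + #|T|).
Proof.
move=> [Fa Fb] cST.
have sub : F \subset (\bigcup_(a in S) [set e in F | e.1 == a]) :|:
                     (\bigcup_(b in T) [set e in F | e.2 == b]).
  apply/subsetP=> e eF; rewrite inE; case/orP: (cST e eF) => h.
  - by apply/orP; left; apply/bigcupP; exists e.1; rewrite // inE eF eqxx.
  - by apply/orP; right; apply/bigcupP; exists e.2; rewrite // inE eF eqxx.
apply: leq_trans (subset_leq_card sub) _.
apply: leq_trans (leq_card_setU _ _) _; rewrite mulnDr.
apply: leq_add; rewrite mulnC -sum_nat_const.
- by apply: leq_trans (card_bigcup_le _ _) _; apply: leq_sum.
- by apply: leq_trans (card_bigcup_le _ _) _; apply: leq_sum.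
Qed.

(** * Alternating paths and Konig's theorem *)

Definition alt_step F M : rel A :=
  fun a a' => [exists b, ((a, b) \in F) && ((a', b) \in M)].

(** A path of [alt_step] lists only the [A]-vertices of an alternating path. Replacing [(a1, b1)] by
    [(a, b1)] in [M] frees [a1], from which the rest of the path augments the new matching; hence
    the induction generalizes [M] and [a]. *)
Lemma augment_path F M a p b :
  M \subset F -> matching M -> a \notin fst @: M -> b \notin snd @: M ->
  path (alt_step F M) a p -> uniq (a :: p) -> (last a p, b) \in F ->
  exists N, [/\ N \subset F, matching N,
    fst @: N = a |: fst @: M & snd @: N = b |: snd @: M].
Proof.
elim: p M a => [|a1 p IH] M a MF mM aM bM /=.
  move=> _ _ abF; exists ((a, b) |: M); split; last 2 first.
  - by rewrite imsetU1.
  - by rewrite imsetU1.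
  - by rewrite subUset sub1set abF.
  - exact: matchingU1.
case/andP=> /existsP[b1 /andP[ab1 a1b1]] pth /andP[an /andP[a1n up]] lF.
have av := matching_avoidsD1 mM a1b1.
have fE : fst @: M = a1 |: fst @: (M :\ (a1, b1)).
  by rewrite -{1}(setD1K a1b1) imsetU1.
have sE : snd @: M = b1 |: snd @: (M :\ (a1, b1)).
  by rewrite -{1}(setD1K a1b1) imsetU1.
have MM : M :\ (a1, b1) \subset M by apply: subsetDl.
pose M' := (a, b1) |: (M :\ (a1, b1)).
have av' : avoids (M :\ (a1, b1)) (a, b1).
  split; last by case: av.
  by move: aM; rewrite fE !inE => /norP[].
have aa1 : a1 != a by apply: contraNneq an => <-; rewrite inE eqxx.
have [|||||||N [NF mN Nf Ns]] := IH M' a1.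
- by rewrite subUset sub1set ab1; apply: subset_trans MF.
- by apply: matchingU1 av'; apply: matchingS mM.
- by rewrite imsetU1 !inE negb_or aa1; case: av.
- by rewrite imsetU1 -sE.
(* The lost edge [(a1, b1)] serves only steps into [a1], and [uniq] keeps the rest of the path away
   from [a1]. *)
- apply: sub_path_in pth => x y yp /existsP[c /andP[xc yc]].
  apply/existsP; exists c; rewrite xc !inE yc !xpair_eqE.
  have -> : (y == a1) = false by apply: contraNF a1n => /eqP <-.
  by rewrite /= orbT.
- by rewrite /= a1n.
- by [].
exists N; split=> //.
- by rewrite Nf imsetU1 fE setUCA.
- by rewrite Ns imsetU1 sE.
Qed.

(** [Z] collects the [A]-vertices reachable from unmatched ones by alternating paths. An edge from
    [Z] to an unmatched vertex yields an augmenting path; otherwise a small cover is read off from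
    [Z]. *)
Lemma augment_or_cover F M :
  M \subset F -> matching M ->
  (exists a b N, [/\ N \subset F, matching N, avoids M (a, b),
    fst @: N = a |: fst @: M & snd @: N = b |: snd @: M]) \/
  (exists S T, cover S T F /\ #|S| + #|T| <= #|M|).
Proof.
move=> MF mM.
pose Z := [set a | [exists a0, (a0 \notin fst @: M) && connect (alt_step F M) a0 a]].
have [/existsP[e /and3P[eF eZ e2]]|none] :=
    boolP [exists e, [&& e \in F, e.1 \in Z & e.2 \notin snd @: M]].
  left; move: eZ; rewrite inE => /existsP[a /andP[aM /connectP[p pth le]]].
  move: le; case/shortenP: pth => q pq uq _ le.
  have [|N [NF mN Nf Ns]] := @augment_path F M a q e.2 MF mM aM e2 pq uq.
    by rewrite -le -surjective_pairing.
  by exists a, e.2, N; split.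
(* The cover consists of the [A]-vertices outside [Z] and the [M]-partners of those inside. An edge
   starting in [Z] ends at a matched vertex, whose partner is again in [Z]. *)
right; exists (~: Z), (snd @: [set e in M | e.1 \in Z]); split.
  move=> [a b] abF /=; rewrite inE; case: (boolP (a \in Z)) => //= aZ.
  have : b \in snd @: M.
    apply: contraNT none => bM; apply/existsP; exists (a, b).
    by rewrite abF aZ bM.
  case/imsetP=> -[a' b'] abM /= bE; subst b'.
  apply/imsetP; exists (a', b) => //; rewrite inE abM /=.
  move: aZ; rewrite !inE => /existsP[a0 /andP[a0M c0]].
  apply/existsP; exists a0; rewrite a0M; apply: connect_trans c0 _.
  by apply: connect1; apply/existsP; exists b; rewrite abF.
(* Unmatched [A]-vertices are reached by the empty path, so every vertex outside [Z] is matched. *)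
have sub : ~: Z \subset fst @: [set e in M | e.1 \notin Z].
  apply/subsetP=> a aZ.
  have : a \in fst @: M.
    move: aZ; apply: contraTT => aM; rewrite !inE negbK.
    by apply/existsP; exists a; rewrite aM connect0.
  case/imsetP=> e eM ae; apply/imsetP; exists e => //.
  by rewrite inE eM -ae; rewrite inE in aZ.
apply: leq_trans (leq_add (leq_trans (subset_leq_card sub) (leq_imset_card _ _))
                          (leq_imset_card _ _)) _.
rewrite addnC -cardsUI [X in _ + X](_ : _ = 0) ?addn0.
  by apply/subset_leq_card/subsetP=> e; rewrite !inE; case: (e \in M).
apply: eq_card0 => e; apply/negbTE/negP=> /setIP[/setIdP[_ eZ] /setIdP[_]].
by rewrite eZ.
Qed.

(** A cover by at most [#|M|] vertices accounts for at most [k * #|M|] edges, too few for [F], so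
    only the augmentation remains. *)
Lemma augment k F M :
  degree_le k F -> M \subset F -> matching M -> k * #|M| < #|F| ->
  exists a b N, [/\ N \subset F, matching N, avoids M (a, b),
    fst @: N = a |: fst @: M & snd @: N = b |: snd @: M].
Proof.
move=> dF MF mM lt; case: (augment_or_cover MF mM) => // -[S [T [cST le]]].
have := cover_card dF cST; rewrite leqNgt (leq_ltn_trans _ lt) //.
by rewrite leq_mul2l le orbT.
Qed.

Lemma card_augment M N a b :
  matching M -> matching N -> avoids M (a, b) -> fst @: N = a |: fst @: M ->
  #|N| = #|M|.+1.
Proof.
move=> [M1 _] [N1 _] [aM _] E.
by rewrite -(card_in_imset N1) E cardsU1 aM (card_in_imset M1).
Qed.

Lemma matching_exists k F j :
  degree_le k F -> k * j < #|F| ->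
  exists M, [/\ M \subset F, matching M & #|M| = j.+1].
Proof.
move=> dF; suff H i : i <= j.+1 -> k * j < #|F| ->
    exists M, [/\ M \subset F, matching M & #|M| = i] by exact: H.
elim: i => [|i IH] lei lt.
  by exists set0; rewrite sub0set cards0; split=> //; split=> x; rewrite inE.
have [M [MF mM cM]] := IH (ltnW lei) lt.
have [|a [b [N [NF mN av Nf Ns]]]] := augment dF MF mM.
  by rewrite cM; apply: leq_ltn_trans lt; rewrite leq_mul2l orbC -ltnS lei.
by exists N; split=> //; rewrite (card_augment mM mN av) ?cM.
Qed.

(** * Upper bound, in terms of pairs *)

(** In the application [p] is [m - 2] and [H] has one edge of each color. The [+ 1] in the bound on
    [H] pays for the edge [e] deleted from [H] before the second augmentation. *)
Lemma rainbow_matching_exists (C : finType) (col : A * B -> C) k p E H :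
  degree_le k E -> k * (3 * p.+1) < #|E| ->
  H \subset E -> {in H &, injective col} -> k * p + 1 < #|H| ->
  exists M, [/\ M \subset E, matching M, #|M| = p.+2 & {in M &, injective col}].
Proof.
move=> dE cE HE colH cH; have dH := degree_leS HE dE.
(* A matching inside [H] is already rainbow, so with [p.+1] edges it lacks just one disjoint edge of
   a new color. *)
have extend M e : M \subset H -> matching M -> #|M| = p.+1 -> e \in E ->
    avoids M e -> col e \notin col @: M ->
    exists M, [/\ M \subset E, matching M, #|M| = p.+2 & {in M &, injective col}].
  move=> MH mM cM eE av ce; exists (e |: M); split.
  - by rewrite subUset sub1set eE (subset_trans MH).
  - exact: matchingU1.
  - by rewrite cardsU1 avoidsNin // cM.
  - apply: inj_in_setU1 => [x y xM yM|y yM cy].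
      by apply: colH; apply: (subsetP MH).
    by case/negP: ce; rewrite -cy imset_f.
have [|M [MH mM cM]] := @matching_exists k H p dH; first lia.
pose F := [set e in E | (e.1 \notin fst @: M) && (e.2 \notin snd @: M)].
have FE : F \subset E by apply/subsetP=> e; rewrite inE => /andP[].
(* The at most [2 * p.+1] ends of [M] cover all edges outside [F], which costs at most two thirds of
   [k * (3 * p.+1)]. *)
have cF : k * p.+1 < #|F|.
  have cov : cover (fst @: M) (snd @: M) (E :\: F).
    by move=> e; rewrite !inE => /andP[+ eE]; rewrite eE -negb_or negbK.
  have := cover_card (degree_leS (subsetDl E F) dE) cov.
  have := cardsD E F; rewrite (setIidPr FE).
  have := subset_leq_card FE.
  have := leq_imset_card fst M; have := leq_imset_card snd M; rewrite cM.
  set s := #|_|; set t := #|_| => ls lt lF eD lc.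
  have : k * (t + s) <= k * (p.+1 + p.+1) by rewrite leq_mul2l leq_add ?orbT.
  lia.
have [N [NF mN cN]] := matching_exists (degree_leS FE dE) cF.
have [/existsP[e /andP[eN ce]]|none] := boolP [exists e, (e \in N) && (col e \notin col @: M)].
  have := subsetP NF _ eN; rewrite inE => /and3P[eE e1 e2].
  exact: (extend M e).
(* Pigeonhole: the [p.+2] edges of [N] use only colors of [M], of which there are at most [p.+1]. *)
have : ~~ [forall e in N, forall f in N, (col e == col f) ==> (e == f)].
  apply/negP=> inj.
  have : #|col @: N| <= #|col @: M|.
    apply/subset_leq_card/subsetP=> _ /imsetP[e eN ->].
    by apply: contraNT none => ce; apply/existsP; exists e; rewrite eN.
  rewrite leqNgt [#|col @: N|]card_in_imset.
    by rewrite cN (leq_ltn_trans (leq_imset_card _ _)) // cM.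
  move=> e f eN fN /eqP cef; apply/eqP.
  by move/forall_inP: inj => /(_ e eN)/forall_inP/(_ f fN)/implyP/(_ cef).
case/forall_inPn=> e1 e1N /forall_inPn[e2 e2N]; rewrite negb_imply => /andP[/eqP c12 ne12].
have /imsetP[e eM ce] : col e1 \in col @: M.
  by apply: contraNT none => ce; apply/existsP; exists e1; rewrite e1N.
have eH := subsetP MH _ eM.
have MDH : M :\ e \subset H :\ e by apply: setSD.
have mMD : matching (M :\ e) by apply: matchingS mM; apply: subsetDl.
have cMD : #|M :\ e| = p by have := cardsD1 e M; rewrite eM cM => -[].
have [|a [b [M1 [M1H mM1 [aM bM] M1f M1s]]]] :=
    augment (degree_leS (subsetDl H [set e]) dH) MDH mMD.
  by move: cH; rewrite (cardsD1 e H) eH cMD addnC ltn_add2l.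
have cM1 : #|M1| = p.+1 by rewrite (card_augment mMD mM1 (conj aM bM)) ?cMD.
(* [M1] lies in [H] without [e], so the color of [e], shared by [e1] and [e2], is still free for the
   last edge. *)
have eNM1 : col e \notin col @: M1.
  apply/imsetP => -[f /(subsetP M1H)/setD1P[fe fH] cf].
  by case/eqP: fe; apply: colH.
have M1H' : M1 \subset H := subset_trans M1H (subsetDl _ _).
have av := matching_avoidsD1 mM eM.
have fE : fst @: M = e.1 |: fst @: (M :\ e) by rewrite -{1}(setD1K eM) imsetU1.
have sE : snd @: M = e.2 |: snd @: (M :\ e) by rewrite -{1}(setD1K eM) imsetU1.
have use f : f \in N -> col f = col e ->
    f.1 \notin a |: fst @: (M :\ e) -> f.2 \notin b |: snd @: (M :\ e) ->
    exists M, [/\ M \subset E, matching M, #|M| = p.+2 & {in M &, injective col}].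
  move=> fN cf f1 f2; apply: (extend M1 f) => //.
  - by apply: (subsetP FE); apply: (subsetP NF).
  - by split; rewrite ?M1f ?M1s.
  - by rewrite cf.
have Nout f : f \in N ->
    [/\ f.1 != e.1, f.2 != e.2, f.1 \notin fst @: (M :\ e) & f.2 \notin snd @: (M :\ e)].
  move=> /(subsetP NF); rewrite inE fE sE !in_setU1 !negb_or => /and3P[_].
  by case/andP=> ? ? /andP[].
have [f11 f12 f13 f14] := Nout _ e1N.
have [f21 f22 f23 f24] := Nout _ e2N.
(* If [a] is an end of [e], only [b] can meet [e1] or [e2], which are disjoint. *)
have [ae|ae] := eqVneq a e.1.
  have [b1|b1] := eqVneq e1.2 b; last first.
    by apply: (use e1); rewrite // in_setU1 negb_or ?ae ?f11 ?b1.
  apply: (use e2); rewrite -?c12 // in_setU1 negb_or ?ae ?f21 //.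
  rewrite f24 -b1 andbT; apply: contraNneq ne12 => e21.
  by case: mN => _ /(_ _ _ e1N e2N) ->.
have [be|be] := eqVneq b e.2.
  have [b1|b1] := eqVneq e1.1 a; last first.
    by apply: (use e1); rewrite // in_setU1 negb_or ?be ?f12 ?b1.
  apply: (use e2); rewrite -?c12 // in_setU1 negb_or ?be ?f22 //.
  rewrite f23 -b1 andbT; apply: contraNneq ne12 => e21.
  by case: mN => /(_ _ _ e1N e2N) ->.
(* Neither [a] nor [b] is an end of [e], so [e] itself can be put back. *)
apply: (extend M1 e) => //; first exact: (subsetP HE).
case: av => av1 av2.
by split; rewrite ?M1f ?M1s !in_setU1 negb_or eq_sym ?ae ?be.
Qed.

End BipartiteMatching.

(** * Translation between edges of the graph and pairs *)

Section Pairs.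

Variables (G : sgraph) (X Y : {set G}).
Hypothesis bip : bipartition X Y.

(** Orienting every edge from [X] to [Y] makes it a single pair, so that counting pairs counts
    edges. *)
Definition edge_pairs : {set G * G} := [set e | (e.1 \in X) && adj e.1 e.2].

Definition pair_edge (e : G * G) : {set G} := [set e.1; e.2].

Lemma bip_notin x : x \in X -> x \notin Y.
Proof. by case: bip => _ /disjointFr dXY _ /dXY ->. Qed.

Lemma edge_pairsP e : e \in edge_pairs -> [/\ e.1 \in X, e.2 \in Y & adj e.1 e.2].
Proof.
rewrite inE => /andP[eX ee]; split=> //.
case: bip => _ _ /(_ _ _ ee); rewrite eX (negbTE (bip_notin eX)).
by rewrite orbF.
Qed.

Lemma edgesE : edges G = pair_edge @: edge_pairs.
Proof.
apply/setP=> e; apply/idP/imsetP.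
  rewrite inE => /existsP[x /existsP[y /andP[xy /eqP->]]].
  case: bip => _ _ /(_ _ _ xy)/orP[]/andP[xX yY].
    by exists (x, y); rewrite // inE /= xX xy.
  by exists (y, x); rewrite ?inE /= ?yY 1?adj_sym ?xy // /pair_edge setUC.
case=> -[x y] /edge_pairsP[/= _ _ xy ->]; rewrite inE.
by apply/existsP; exists x; apply/existsP; exists y; rewrite xy eqxx.
Qed.

Lemma pair_edge_inj : {in edge_pairs &, injective pair_edge}.
Proof.
move=> [x y] [x' y'] /edge_pairsP[/= xX yY _] /edge_pairsP[/= xX' yY' _] E.
have : x \in pair_edge (x', y') by rewrite -E !inE eqxx.
have : y \in pair_edge (x', y') by rewrite -E !inE eqxx orbT.
rewrite !inE /= => /orP[]/eqP yE.
  by have := bip_notin xX'; rewrite -yE yY.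
case/orP=> /eqP xE; last by have := bip_notin xX; rewrite xE yY'.
by rewrite xE yE.
Qed.

Section Regular.

Variable k : nat.
Hypothesis reg : regular k G.

(** Each edge has a unique end in [X], so the degrees over [S] add up without overlap. [S = X] gives
    the total number of edges; [S] of size [m - 2] serves the lower bound. *)
Lemma card_edge_pairs_fst (S : {set G}) : S \subset X ->
  #|[set e in edge_pairs | e.1 \in S]| = k * #|S|.
Proof.
move=> /subsetP SX; rewrite mulnC -sum_nat_const -sum1_card.
rewrite (partition_big fst (mem S)) /= => [|e]; last by rewrite inE => /andP[].
apply: eq_bigr => x xS; rewrite sum1_card -(reg x).
rewrite -(@card_imset _ _ (pair x) [set y | adj x y]) => [|y y' []] //.
apply: eq_card => -[x' y]; rewrite [LHS]unfold_in /=; apply/idP/imsetP.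
  by rewrite !inE /= => /andP[/andP[/andP[_ xy] _] /eqP xE]; exists y; rewrite ?inE -xE.
case=> y'; rewrite inE => xy [-> ->].
by rewrite !inE /= xy xS eqxx SX.
Qed.

Lemma degree_le_edge_pairs : degree_le k edge_pairs.
Proof.
split=> v; rewrite -(reg v).
- rewrite -(@card_in_imset _ _ snd) => [|[x y] [x' y']].
    apply/subset_leq_card/subsetP=> _ /imsetP[[x y] + ->].
    by rewrite !inE /= => /andP[/andP[_ xy] /eqP <-].
  by rewrite !inE /= => /andP[_ /eqP->] /andP[_ /eqP->] ->.
- rewrite -(@card_in_imset _ _ fst) => [|[x y] [x' y']].
    apply/subset_leq_card/subsetP=> _ /imsetP[[x y] + ->].
    by rewrite !inE /= adj_sym => /andP[/andP[_ xy] /eqP <-].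
  by rewrite !inE /= => /andP[_ /eqP->] /andP[_ /eqP->] ->.
Qed.

End Regular.

(** [enum_val] numbers the pairs of [M], and the [i]-th edge of [matching_graph] goes to the [i]-th
    pair. Ends on the same side differ because [M] is a matching, ends on opposite sides because [X]
    and [Y] are disjoint. *)
Lemma has_rainbow_matching m r (c : {ffun {set G} -> 'I_r}) (M : {set G * G}) :
  M \subset edge_pairs -> matching M -> #|M| = m ->
  {in M &, injective (c \o pair_edge)} -> has_rainbow (matching_graph m) c.
Proof.
move=> /subsetP ME [M1 M2] cM cI; subst m.
pose f : {ffun matching_graph #|M| -> G} :=
  [ffun u : 'I_#|M| * bool => if u.2 then (enum_val u.1).2 else (enum_val u.1).1].
have fI : injective f.
  move=> [i b] [j d]; rewrite !ffunE /=.
  have [iM jM] := (enum_valP i, enum_valP j).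
  have [iX iY _] := edge_pairsP (ME _ iM); have [jX jY _] := edge_pairsP (ME _ jM).
  case: b d => [] [] E.
  - by rewrite (enum_val_inj (M2 _ _ iM jM E)).
  - by have := bip_notin jX; rewrite -E iY.
  - by have := bip_notin iX; rewrite E jY.
  - by rewrite (enum_val_inj (M1 _ _ iM jM E)).
have fE (e : {set matching_graph #|M|}) : e \in edges (matching_graph #|M|) ->
    exists2 p, p \in M & f @: e = pair_edge p.
  rewrite inE => /existsP[[i b] /existsP[[j d] /andP[/andP[/eqP /= ij bd] /eqP->]]].
  subst j; exists (enum_val i); first exact: enum_valP.
  rewrite imsetU1 imset_set1 !ffunE /= /pair_edge.
  by case: b d bd => [] [] //= _; rewrite setUC.
apply/existsP; exists (f @: setT); apply/existsP.
exists [set f @: (e : {set matching_graph #|M|}) | e in edges (matching_graph #|M|)].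
apply/and3P; split.
- apply/andP; split.
    apply/subsetP=> _ /imsetP[e /fE[p pM E] ->].
    by rewrite E edgesE imset_f ?ME.
  by apply/forall_inP=> _ /imsetP[e _ ->]; apply/imsetS/subsetT.
- by apply/existsP; exists f; rewrite !eqxx !andbT; apply/injectiveP.
- apply/forall_inP=> _ /imsetP[e /fE[p pM ->] ->].
  apply/forall_inP=> _ /imsetP[e' /fE[q qM ->] ->].
  by apply/implyP=> /eqP E; rewrite (cI p q).
Qed.

End Pairs.

(* Of [m] disjoint edges, at most one has the color [z] and at most [#|S|] meet [S]. *)
Lemma rainbow_matching_bound (G : sgraph) m r (c : {ffun {set G} -> 'I_r})
    (S : {set G}) z :
  (forall e, e \in edges G -> [disjoint e & S] -> c e = z) ->
  has_rainbow (matching_graph m) c -> m <= #|S|.+1.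
Proof.
move=> cz /existsP[W /existsP[F /and3P[/andP[/subsetP FE _]]]].
move=> /existsP[f /and3P[/injectiveP fI _ /eqP Fdef]] /forall_inP rF.
pose e i : {set matching_graph m} := [set (i, false); (i, true)].
have eF i : f @: e i \in F.
  rewrite -Fdef; apply: imset_f; rewrite inE.
  apply/existsP; exists (i, false); apply/existsP; exists (i, true).
  by rewrite /adj /= /matching_adj /= !eqxx.
have cI i j : c (f @: e i) = c (f @: e j) -> i = j.
  move=> E; have /forall_inP/(_ _ (eF j)) := rF _ (eF i).
  rewrite E eqxx /= => /eqP/(imset_inj fI) ij.
  have : (i, false) \in e j by rewrite -ij !inE eqxx.
  by rewrite !inE !xpair_eqE => /orP[]/andP[/eqP].
pose D := [set i | [disjoint f @: e i & S]].
have D1 : #|D| <= 1.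
  apply/card_le1_eqP=> i j; rewrite !inE => iD jD; apply: cI.
  by rewrite (cz _ (FE _ (eF i)) iD) (cz _ (FE _ (eF j)) jD).
(* Choosing [v] for all indices at once needs a total statement, hence the implication and an
   arbitrary vertex when [i] is in [D]. *)
have vtx (i : 'I_m) : exists v, (i \in ~: D) ==> (v \in f @: e i) && (v \in S).
  case: (boolP (i \in D)) => [iD|]; first by exists (f (i, true)); rewrite inE iD.
  rewrite inE -setI_eq0 => /set0Pn[v]; rewrite inE => vS.
  by exists v; rewrite vS implybT.
have [v vP] := fin_all_exists vtx.
(* As [f] is injective, the images of distinct matching edges are disjoint and meet [S] in different
   vertices. *)
have vI : {in ~: D &, injective v}.
  move=> i j iD jD E.
  have /andP[/imsetP[u ui uE] _] := implyP (vP i) iD.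
  have /andP[/imsetP[w wj wE] _] := implyP (vP j) jD.
  have uw : u = w by apply: fI; rewrite -uE E wE.
  by move: ui wj; rewrite -uw !inE => /orP[]/eqP-> /orP[]/eqP[].
have : #|~: D| <= #|S|.
  rewrite -(card_in_imset vI); apply/subset_leq_card/subsetP=> _ /imsetP[i iD ->].
  by have /andP[] := implyP (vP i) iD.
by have := cardsC D; rewrite card_ord; lia.
Qed.

(** * The two bounds on the rainbow number *)

Theorem theorem2p5 (m k n : nat) (G : sgraph) (X Y : {set G}) :
  2 <= m -> 3 <= k -> k <= n -> 3 * (m - 1) < n ->
  regular k G -> bipartition X Y -> #|X| = n -> #|Y| = n ->
  rb G (matching_graph m) = k * (m - 2) + 2.
Proof.
move=> m2 k3 _ ltn3 reg bip cX _.
have cE : #|edge_pairs X| = k * n.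
  rewrite -cX -(card_edge_pairs_fst reg (subxx X)).
  by apply: eq_card => e; rewrite !inE andbAC andbb.
rewrite /rb; case: ex_minnP => r /andP[r0 /forallP fr] minr.
apply/eqP; rewrite eqn_leq; apply/andP; split.
  apply: minr; rewrite addn2 /=; apply/forallP=> c; apply/implyP=> /eqP cS.
  have pre i : exists e, (e \in edge_pairs X) && (c (pair_edge e) == i).
    have : i \in c @: edges G by rewrite cS inE.
    rewrite (edgesE bip) => /imsetP[_ /imsetP[e eE ->] ->].
    by exists e; rewrite eE eqxx.
  (* [h] picks one edge of each color; its image serves as [H]. *)
  have [h hP] := fin_all_exists pre.
  have ch i : c (pair_edge (h i)) = i by case/andP: (hP i) => _ /eqP.
  have [||||M [ME mM cM cI]] := @rainbow_matching_exists _ _ _ (c \o @pair_edge G)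
      k (m - 2) (edge_pairs X) (h @: setT) (degree_le_edge_pairs X reg).
  - by rewrite cE ltn_pmul2l ?(leq_trans _ k3) // (_ : (m - 2).+1 = m - 1) //; lia.
  - by apply/subsetP=> _ /imsetP[i _ ->]; case/andP: (hP i).
  - by move=> _ _ /imsetP[i _ ->] /imsetP[j _ ->] /=; rewrite !ch => ->.
  - rewrite card_imset ?cardsT ?card_ord ?addn1 //.
    exact: (can_inj (g := c \o @pair_edge G) ch).
  by apply: (has_rainbow_matching bip ME mM) cI; rewrite cM; lia.
rewrite leqNgt; apply/negP=> ltr.
have [S SX cS] : exists2 S : {set G}, S \subset X & #|S| = m - 2.
  have : m - 2 <= #|X| by rewrite cX; lia.
  by case/card_geqP=> s [us <- sX]; exists [set x in s];
     [apply/subsetP=> x; rewrite inE; exact: sX | rewrite cardsE (card_uniqP us)].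
(* An edge at [x0] misses [S], so the common color [ord0] really occurs. *)
have [x0 x0X x0S] : exists2 x, x \in X & x \notin S.
  apply/subsetPn; apply/negP=> /subset_leq_card; rewrite cX cS; lia.
have [y0 xy0] : exists y, adj x0 y.
  have : 0 < #|[set y | adj x0 y]| by rewrite reg; lia.
  by case/card_gt0P=> y; rewrite inE; exists y.
case: r r0 fr minr ltr => // r _ fr _ ltr.
pose ES := [set e in edges G | ~~ [disjoint e & S]].
(* Now that [r] has become [r.+1], there are [r] colors besides the common one, and [ES] must supply
   an edge for each. *)
have cES : r <= size (enum ES).
  rewrite -cardE; apply: (@leq_trans (k * (m - 2))); first by lia.
  rewrite -cS -(card_edge_pairs_fst reg SX).
  rewrite -(card_in_imset (f := @pair_edge G)) => [|e f].
    apply/subset_leq_card/subsetP=> _ /imsetP[e + ->].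
    rewrite inE => /andP[eE eS]; rewrite inE (edgesE bip) imset_f //=.
    by apply/pred0Pn; exists e.1; rewrite /= eS !inE eqxx.
  by move=> /setIdP[eE _] /setIdP[fE _]; apply: (pair_edge_inj bip).
(* The shift by one reserves [ord0] for the edges missing [S]. On values beyond [r], [inord] falls
   back to [ord0], which merges the surplus edges of [ES] into the common color. *)
pose c : {ffun {set G} -> 'I_r.+1} := [ffun e =>
  if e \in ES then inord (index e (enum ES)).+1 else ord0].
have sub : is_edge_coloring c.
  rewrite /is_edge_coloring -subTset; apply/subsetP=> i _.
  have [i0|i0] := posnP i.
    apply/imsetP; exists (pair_edge (x0, y0)).
      by rewrite (edgesE bip) imset_f // inE x0X.
    rewrite ffunE ifF; first exact: val_inj.
    rewrite inE; apply/negbTE; rewrite negb_and negbK; apply/orP; right.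
    have [_ /= y0Y _] : [/\ x0 \in X, y0 \in Y & adj x0 y0].
      by apply: (edge_pairsP bip (e := (x0, y0))); rewrite inE x0X.
    rewrite disjoint_subset; apply/subsetP=> v; rewrite !inE => /orP[]/eqP-> //=.
    by apply: contraL y0Y => /(subsetP SX)/(bip_notin bip).
  have lt : i.-1 < size (enum ES) by apply: leq_trans cES; have := ltn_ord i; lia.
  have eES : nth set0 (enum ES) i.-1 \in ES by rewrite -mem_enum mem_nth.
  apply/imsetP; exists (nth set0 (enum ES) i.-1).
    by move: eES; rewrite inE => /andP[].
  by rewrite ffunE eES index_uniq ?enum_uniq // prednK // inord_val.
have := fr c; rewrite sub => /(@rainbow_matching_bound _ _ _ _ S ord0).
move=> h; have : m <= #|S|.+1.
  by apply: h => e eE dS; rewrite ffunE inE eE dS.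
by rewrite cS; lia.
Qed.
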